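(* Let $N_{32}$ be the free nilpotent group of rank $3$ and nilpotency class $2$. Then its Reidemeister spectrum is $$Spec_R(N_{32}) = \{2n-1 \mid n \in \mathbb{N}\} \cup \{4n \mid n\in\mathbb{N}\} \cup \{\infty\}.$$
   Context: Here $\mathbb{N}$ denotes the positive integers. The free nilpotent group $N_{rc}$ of rank $r$ and class $c$ is $F_r/\gamma_{c+1}(F_r)$, where $F_r$ is the free group of rank $r$ and $\gamma_i$ denotes the $i$-th term of the lower central series ($\gamma_1(G)=G$). Automorphisms are written on the right: $x\varphi$ is the image of $x$ under $\varphi$. For a group $G$ and an automorphism $\varphi$ of $G$, elements $g,f\in G$ are $\varphi$-twisted conjugate if there exists $x\in G$ with $(x\varphi)g = fx$. This is an equivalence relation; the Reidemeister number $R(\varphi)$ is the number of its equivalence classes, with $R(\varphi)=\infty$ if there are infinitely many. The Reidemeister spectrum of $G$ is $Spec_R(G)=\{R(\varphi)\mid \varphi\in Aut(G)\}$. *)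

(* Defs.v *)
From HB Require Import structures.
From mathcomp Require Import all_boot finmap.
From mathcomp Require Import boolp classical_sets cardinality constructive_ereal.

Set Implicit Arguments.
Unset Strict Implicit.
Unset Printing Implicit Defensive.

Local Open Scope classical_set_scope.
Local Open Scope group_scope.

(* The letter (a, false) stands for the generator a, (a, true) for its inverse. *)
Section FreeGroup.
Variable T : choiceType.
Implicit Types (x y : T * bool) (u v w : seq (T * bool)).

Definition linv x := (x.1, ~~ x.2).

Definition reduced w := sorted (fun x y => y != linv x) w.

(* [push x w] is the reduced form of x :: w when w is reduced, so that
   [foldr push w u] is the reduced form of u ++ w. *)
Definition push x w :=
  if w is y :: w' then if y == linv x then w' else x :: w else [:: x].

Record free_group := FreeGroup { word :> seq (T * bool); _ : reduced word }.

HB.instance Definition _ := [isSub for word].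
HB.instance Definition _ := [Choice of free_group by <:].

Lemma linvK : involutive linv.
Proof. by case=> a b; rewrite /linv negbK. Qed.

Lemma reduced_push x w : reduced w -> reduced (push x w).
Proof.
case: w => [|y w] //= red; case: eqP => [_|/eqP]; first exact: path_sorted red.
by move=> ney; rewrite /= ney.
Qed.

Lemma reduced_foldr u w : reduced w -> reduced (foldr push w u).
Proof. by move=> red; elim: u => //= x u /(reduced_push x). Qed.

Lemma pushK x w : reduced w -> push (linv x) (push x w) = w.
Proof.
case: w => [|y w] /= red; first by rewrite linvK eqxx.
case: eqP => [ey|_]; last by rewrite /= linvK eqxx.
rewrite ey in red *; case: w red => [|z w] //= /andP[nez _].
by rewrite (negPf nez).
Qed.

Lemma foldr_push x u w : reduced u -> reduced w ->
  foldr push w (push x u) = push x (foldr push w u).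
Proof.
case: u => [|y u] //= redu redw; case: eqP => [->|//].
have /pushK := reduced_foldr u redw => /(_ (linv x)).
by rewrite linvK.
Qed.

Lemma foldr_pushA u v w : reduced v -> reduced w ->
  foldr push w (foldr push v u) = foldr push (foldr push w v) u.
Proof.
move=> redv redw; elim: u => //= x u IHu.
by rewrite foldr_push ?IHu //; apply: reduced_foldr.
Qed.

Lemma foldr_push0 w : reduced w -> foldr push [::] w = w.
Proof.
elim: w => //= x w IHw red; rewrite IHw; last exact: path_sorted red.
by case: w red {IHw} => //= y w /andP[/negPf->].
Qed.

Lemma reduced_inv w : reduced w -> reduced (rev (map linv w)).
Proof.
rewrite /reduced rev_sorted sorted_map; apply: sub_sorted => x y /=.
by apply: contraNneq => /(can_inj linvK) ->; rewrite linvK.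
Qed.

Lemma foldr_push_inv u w : reduced w ->
  foldr push (foldr push w u) (rev (map linv u)) = w.
Proof.
move=> red; elim: u => //= x u IHu; rewrite rev_cons foldr_rcons pushK //.
exact: reduced_foldr.
Qed.

Definition fg_one := @FreeGroup [::] isT.
Definition fg_mul (u v : free_group) : free_group :=
  FreeGroup (reduced_foldr u (valP v)).
Definition fg_inv (u : free_group) : free_group :=
  FreeGroup (reduced_inv (valP u)).

Lemma fg_mulA : associative fg_mul.
Proof.
by move=> u v w; apply: val_inj; rewrite /= foldr_pushA //; apply: valP.
Qed.

Lemma fg_mul1 : left_id fg_one fg_mul.
Proof. by move=> u; apply: val_inj. Qed.

Lemma fg_mulr1 : right_id fg_one fg_mul.
Proof. by move=> u; apply: val_inj; rewrite /= foldr_push0 //; apply: valP. Qed.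

Lemma fg_mulV : left_inverse fg_one fg_inv fg_mul.
Proof.
move=> u; apply: val_inj => /=.
by rewrite -{1}(foldr_push0 (valP u)) foldr_push_inv.
Qed.

Lemma fg_invK : involutive fg_inv.
Proof.
move=> u; apply: val_inj; rewrite /= map_rev revK -map_comp map_id_in //.
by move=> x _; apply: linvK.
Qed.

Lemma fg_mulrV : right_inverse fg_one fg_inv fg_mul.
Proof. by move=> u; rewrite -{1}[u]fg_invK fg_mulV. Qed.

HB.instance Definition _ :=
  isGroup.Build free_group fg_mulA fg_mul1 fg_mulr1 fg_mulV fg_mulrV.

End FreeGroup.

Section Subgroups.
Variable G : groupType.
Implicit Types A B H : set G.

Definition generated A : set G := smallest [set H | group_closed [in H]] A.

Definition commutator A B : set G :=
  generated [set [~ a, b] | a in A & b in B].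

(* Indexed from 1, the term of index 0 being also the whole group. *)
Definition lower_central n : set G :=
  iter n.-1 (fun A => commutator A setT) setT.

Definition is_normal H :=
  group_closed [in H] /\ forall x y, H x -> H (x ^ y).

Record normal_subgroup := NormalSubgroup {
  normal_set :> set G;
  normal_setP : is_normal normal_set
}.

Lemma group_closedE H : group_closed [in H] <->
  H 1 /\ forall x y, H x -> H y -> H (x / y).
Proof.
split=> -[H1 HF].
  split=> [|x y Hx Hy]; first exact: set_mem.
  by apply: set_mem; apply: (HF x y); apply: mem_set.
split=> [|x y /set_mem Hx /set_mem Hy]; first exact: mem_set.
by apply: mem_set; apply: HF.
Qed.

Lemma generated_group A : group_closed [in generated A].
Proof.
apply/group_closedE; split=> [H [/group_closedE[]] // |x y Ax Ay H HA].
by have [/group_closedE[_ HF] _] := HA; apply: HF; [apply: Ax | apply: Ay].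
Qed.

Lemma generated_normal A :
  (forall x y, A x -> A (x ^ y)) -> is_normal (generated A).
Proof.
move=> AJ; split=> [|x y Ax H [/group_closedE[H1 HF] sAH]].
  exact: generated_group.
apply: (Ax [set z | H (z ^ y)]); split=> [|z Az]; last exact/sAH/AJ.
apply/group_closedE; split=> [|u v Hu Hv] /=; first by rewrite conj1g.
by rewrite conjMg conjVg; apply: HF.
Qed.

Lemma lower_central_normal n : is_normal (lower_central n).
Proof.
rewrite /lower_central; elim: n.-1 => [|m [_ IH]] /=.
  by split=> //; apply/group_closedE.
apply: generated_normal => _ y [a Aa [b _ <-]].
by exists (a ^ y); [apply: IH | exists (b ^ y); rewrite // conjRg].
Qed.

Definition gamma n := NormalSubgroup (lower_central_normal n).

End Subgroups.

Section Quotient.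
Variables (G : groupType) (H : normal_subgroup G).
Implicit Types x y z : G.

Definition coset_rel x y := x^-1 * y \in normal_set H.

Lemma coset_relE x y : coset_rel x y = normal_set H (x^-1 * y) :> Prop.
Proof. by apply/propext; split=> [/set_mem|/mem_set]. Qed.

Let H1 : normal_set H 1.
Proof. by have [/group_closedE[]] := normal_setP H. Qed.
Let HF x y : normal_set H x -> normal_set H y -> normal_set H (x / y).
Proof. by have [/group_closedE[_ HF] _] := normal_setP H; apply: HF. Qed.
Let HV x : normal_set H x -> normal_set H x^-1.
Proof. by rewrite -[x^-1]mul1g; apply: HF. Qed.
Let HM x y : normal_set H x -> normal_set H y -> normal_set H (x * y).
Proof. by move=> Hx /HV; rewrite -[in x * y](invgK y); apply: HF. Qed.
Let HJ x y : normal_set H x -> normal_set H (x ^ y).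
Proof. by have [_ HJ] := normal_setP H; apply: HJ. Qed.

Lemma coset_refl : reflexive coset_rel.
Proof. by move=> x; rewrite coset_relE mulVg. Qed.

Lemma coset_sym : symmetric coset_rel.
Proof.
by move=> x y; apply/idP/idP; rewrite !coset_relE => /HV; rewrite invgM invgK.
Qed.

Lemma coset_trans : transitive coset_rel.
Proof.
move=> y x z; rewrite !coset_relE => Hxy /(HM Hxy).
by rewrite -mulgA mulVKg.
Qed.

Canonical coset_equiv := EquivRel coset_rel coset_refl coset_sym coset_trans.

Definition quotient_group := {eq_quot coset_equiv}%qT.

HB.instance Definition _ := Choice.on quotient_group.
HB.instance Definition _ := EqQuotient.on quotient_group.

Local Open Scope quotient_scope.
Local Notation pi := (\pi_quotient_group).

Definition qg_one : quotient_group := pi 1.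
Definition qg_mul (a b : quotient_group) : quotient_group :=
  pi (repr a * repr b).
Definition qg_inv (a : quotient_group) : quotient_group := pi (repr a)^-1.

Lemma eq_piP x y : pi x = pi y <-> coset_rel x y.
Proof. by split=> [/eqmodP|xy]; last exact/eqmodP. Qed.

Lemma reprP x : coset_rel (repr (pi x)) x.
Proof. by apply/eq_piP; rewrite reprK. Qed.

Lemma coset_relM x x' y y' :
  coset_rel x x' -> coset_rel y y' -> coset_rel (x * y) (x' * y').
Proof.
rewrite !coset_relE => /(@HJ _ y) Hx /(HM Hx).
by rewrite conjgE invgM !mulgA mulgK.
Qed.

Lemma piM x y : qg_mul (pi x) (pi y) = pi (x * y).
Proof. by apply/eq_piP/coset_relM; apply: reprP. Qed.

Lemma piV x : qg_inv (pi x) = pi x^-1.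
Proof.
apply/eq_piP; have := reprP x; rewrite !coset_relE => /HV/(@HJ _ x^-1).
by rewrite conjgE !invgM !invgK !mulgA mulgV mul1g.
Qed.

Lemma qg_mulA : associative qg_mul.
Proof.
move=> a b c; rewrite -[a]reprK -[b]reprK -[c]reprK.
by rewrite (piM (repr b)) (piM (repr a) (repr b)) !piM mulgA.
Qed.

Lemma qg_mul1 : left_id qg_one qg_mul.
Proof. by move=> a; rewrite -[a]reprK piM mul1g. Qed.

Lemma qg_mulr1 : right_id qg_one qg_mul.
Proof. by move=> a; rewrite -[a]reprK piM mulg1. Qed.

Lemma qg_mulV : left_inverse qg_one qg_inv qg_mul.
Proof. by move=> a; rewrite -[a]reprK piV piM mulVg. Qed.

Lemma qg_mulrV : right_inverse qg_one qg_inv qg_mul.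
Proof. by move=> a; rewrite -[a]reprK piV piM mulgV. Qed.

HB.instance Definition _ :=
  isGroup.Build quotient_group qg_mulA qg_mul1 qg_mulr1 qg_mulV qg_mulrV.

End Quotient.

Definition free_nilpotent (r c : nat) : groupType :=
  quotient_group (gamma (free_group 'I_r) c.+1).

Section Reidemeister.
Variable G : groupType.
Implicit Types (phi : {multiplicative G -> G}) (f g x : G).

Definition twisted_conjugate phi g f := exists x, phi x * g = f * x.

Definition twisted_classes phi : set (set G) :=
  [set [set g | twisted_conjugate phi g f] | f in setT].

(* The value -oo of [\bar nat] is never taken. *)
Definition reidemeister_number phi : \bar nat :=
  if `[< finite_set (twisted_classes phi) >]
  then EFin #|` fset_set (twisted_classes phi)| else +oo%E.

Definition reidemeister_spectrum : set (\bar nat) :=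
  reidemeister_number @` [set phi : {multiplicative G -> G} | bijective phi].

End Reidemeister.

(* Main.v *)
Require Import Defs.
From HB Require Import structures.
From mathcomp Require Import all_boot all_order all_algebra zify ssrAC finmap.
From mathcomp Require Import boolp classical_sets functions cardinality.
From mathcomp Require Import constructive_ereal.

(** The free nilpotent group of rank 3 and class 2 is isomorphic to a
    Heisenberg-like group [heis] on Z^3 x Z^3
    ([free_nilpotent32_heis]), in which the commutator of two elements is the
    cross product, up to sign, of their first components.

    An automorphism of [heis] acts on the abelianization Z^3 by a matrix [A] of
    determinant d = 1 or -1, and on the central Z^3 by a matrix [L].  Since the
    cross product is preserved, [L] is the cofactor matrix of [A]
    ([cofactorP]), so that L A^T = d.  Conversely every such [A] is induced by
    an automorphism, because the free nilpotent group has the universal property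
    of a free object among the groups of class 2 ([heis_realise]).

    When [A - 1] is nonsingular, twisted conjugation acts on first components
    by translation by the lattice of [A - 1], and, the first component being
    fixed, on second components by translation by the lattice of [L - 1].  Hence
    the Reidemeister number is the product of the indices of these two lattices,
    which are absolute values of determinants ([coker_index]); it is infinite as
    soon as one of the determinants vanishes.  From (L - 1) A^T = (d - A)^T one
    gets |det (L - 1)| = |det (A - d)|, so that

      R = |det (A - 1)| |det (A - d)|, read as infinity when it is zero.

    As d is congruent to 1 modulo 2, the two factors have the same parity and R
    is odd or divisible by 4 ([odd_or_4dvd]).  All these values occur: for
    the companion matrix of x^3 - a x^2 + b x + 1 one has d = -1 and
    R = |a - b - 2| |a + b|, where a + b may be given the value 1 or 2 and the
    other factor any value of the same parity. *)

Set Implicit Arguments.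
Unset Strict Implicit.
Unset Printing Implicit Defensive.

Import GRing.Theory Num.Theory Order.TTheory.

Local Open Scope quotient_scope.
Local Open Scope card_scope.
Local Open Scope classical_set_scope.
Local Open Scope group_scope.

(** * Twisted conjugacy classes and their number *)

Section Morphisms.
Variables (G H : groupType) (f : G -> H).
Hypothesis fM : {morph f : x y / x * y}.

Lemma morph_one : f 1 = 1.
Proof. by apply: (mulgI (f 1)); rewrite -fM !mulg1. Qed.

Lemma morph_inv : {morph f : x / x^-1}.
Proof. by move=> x; apply/esym/mulg1_eq; rewrite -fM mulgV morph_one. Qed.

Lemma morph_comm : {morph f : x y / [~ x, y]}.
Proof. by move=> x y; rewrite /commg /conjg !fM !morph_inv. Qed.

End Morphisms.

Section TwistedEquiv.
Variable G : groupType.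
Variable phi : {multiplicative G -> G}.

Lemma twisted_conjugate_refl g : twisted_conjugate phi g g.
Proof. by exists 1; rewrite morph_one ?mul1g ?mulg1 //; apply: gmulfM. Qed.

Lemma twisted_conjugate_sym f g :
  twisted_conjugate phi g f -> twisted_conjugate phi f g.
Proof.
have pM : {morph phi : x y / x * y} by exact: gmulfM.
move=> [x xP]; exists x^-1; rewrite (morph_inv pM); apply: (mulgI (phi x)).
by rewrite mulVKg mulgA xP mulgK.
Qed.

Lemma twisted_conjugate_trans f g h :
  twisted_conjugate phi g f -> twisted_conjugate phi h g ->
  twisted_conjugate phi h f.
Proof.
move=> [x xP] [y yP]; exists (x * y).
by rewrite gmulfM -mulgA yP mulgA xP mulgA.
Qed.

End TwistedEquiv.

Section Counting.
Variable G : groupType.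
Implicit Types phi : {multiplicative G -> G}.

Lemma reidemeister_number_fin phi (T : finType) (k : G -> T) :
    (forall t, exists g, k g = t) ->
    (forall f g, twisted_conjugate phi g f <-> k g = k f) ->
  reidemeister_number phi = EFin #|T|.
Proof.
move=> k_surj kP.
have classesE : twisted_classes phi = (fun t => [set g | k g = t]) @` [set: T].
  apply/seteqP; split=> [_ [f _ <-]|_ [t _ <-]].
    by exists (k f) => //; apply/seteqP; split=> g /= /kP.
  have [f <-] := k_surj t; exists f => //.
  by apply/seteqP; split=> g /= /kP.
have cardE : twisted_classes phi #= `I_#|T|.
  rewrite classesE; apply: card_eq_trans (inj_card_eq _) _.
    move=> s t _ _ /seteqP[/= st _]; have [g gs] := k_surj s.
    by rewrite -gs; apply: st.
  apply: card_eq_trans (card_esym card_II).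
  have <- : [set enum_rank t | t in [set: T]] = [set: 'I_#|T|].
    by apply/seteqP; split=> // i _; exists (enum_val i); rewrite ?enum_valK.
  by rewrite card_eq_sym inj_card_eq // => x y _ _; apply: enum_rank_inj.
rewrite /reidemeister_number (card_fset_set cardE); case: asboolP => // -[].
by exists #|T|.
Qed.

Lemma reidemeister_number_inf phi (s : nat -> G) :
    (forall i j, twisted_conjugate phi (s i) (s j) -> i = j) ->
  reidemeister_number phi = +oo%E.
Proof.
move=> s_inj; rewrite /reidemeister_number; case: asboolP => // fin.
case: infinite_nat.
pose c i := [set g | twisted_conjugate phi g (s i)].
have c_inj : {in [set: nat] &, injective c}.
  by move=> i j _ _ /seteqP[/(_ (s i)) cij _]; apply/s_inj/cij/twisted_conjugate_refl.
rewrite -(eq_finite_set (inj_card_eq c_inj)).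
by apply: sub_finite_set fin => _ [i _ <-]; exists (s i).
Qed.

End Counting.

Section IsoInvariance.
Variables (G H : groupType) (h : {multiplicative G -> H}) (h' : H -> G).
Hypotheses (hK : cancel h h') (h'K : cancel h' h).

(** An isomorphism [h] with [psi \o h = h \o phi] carries twisted classes of
    [phi] onto twisted classes of [psi]. *)
Lemma reidemeister_number_conj (phi : {multiplicative G -> G})
    (psi : {multiplicative H -> H}) :
  (forall x, psi (h x) = h (phi x)) ->
  reidemeister_number psi = reidemeister_number phi.
Proof.
move=> psih.
have tcE f g : twisted_conjugate psi (h g) (h f) <-> twisted_conjugate phi g f.
  split=> [] [x xP]; last by exists (h x); rewrite psih -!gmulfM xP.
  exists (h' x); apply: (can_inj hK).
  by rewrite !gmulfM -psih h'K.
have classesE : twisted_classes psi = (image^~ h) @` twisted_classes phi.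
  have imE f : [set g | twisted_conjugate psi g (h f)]
      = h @` [set g | twisted_conjugate phi g f].
    apply/seteqP; split=> [g gf|_ [g gf <-]]; last exact/tcE.
    by exists (h' g); rewrite ?h'K //; apply/tcE; rewrite h'K.
  apply/seteqP; split=> [_ [f _ <-]|_ [_ [f _ <-] <-]].
    rewrite -[f]h'K imE; exists [set g | twisted_conjugate phi g (h' f)] => //.
    by exists (h' f).
  by exists (h f); rewrite // imE.
have im_inj : {in twisted_classes phi &, injective (image^~ h)}.
  move=> A B _ _ AB; apply/seteqP; have hI := can_inj hK.
  by split=> x; rewrite -!(image_inj hI) AB.
have ce := inj_card_eq im_inj; rewrite -classesE in ce.
rewrite /reidemeister_number (eq_finite_set ce); case: asboolP => // -[n fin].
by rewrite (card_fset_set fin) (card_fset_set (card_eq_trans ce fin)).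
Qed.

Lemma reidemeister_spectrum_sub :
  reidemeister_spectrum H `<=` reidemeister_spectrum G.
Proof.
move=> _ [psi [psi' psiK psi'K] <-].
have phiM : {morph h' \o psi \o h : x y / x * y}.
  by move=> x y /=; rewrite !gmulfM (can2_gmulfM hK h'K).
pose phi : {multiplicative G -> G} :=
  HB.pack (h' \o psi \o h) (isMultiplicative.Build G G _ phiM).
exists phi; last by symmetry; apply: reidemeister_number_conj => x /=; rewrite h'K.
exists (h' \o psi' \o h) => x /=; first by rewrite h'K psiK.
by rewrite h'K psi'K.
Qed.
End IsoInvariance.

Lemma reidemeister_spectrum_iso (G H : groupType) (h : {multiplicative G -> H}) :
  bijective h -> reidemeister_spectrum G = reidemeister_spectrum H.
Proof.
move=> [h' hK h'K]; apply/seteqP; split; last exact: reidemeister_spectrum_sub hK h'K.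
have h'M : {morph h' : x y / x * y} by exact: can2_gmulfM hK h'K.
pose g : {multiplicative H -> G} := HB.pack h' (isMultiplicative.Build H G h' h'M).
exact: (@reidemeister_spectrum_sub H G g h h'K hK).
Qed.

(** * The universal property of the free nilpotent groups of class 2 *)

Section FreeLift.
Variables (T : choiceType) (H : groupType) (g : T -> H).

Definition letter (x : T * bool) : H := if x.2 then (g x.1)^-1 else g x.1.
(** The product is taken over a word that need not be reduced, so that
    multiplicativity reduces to the case of one letter pushed onto a word. *)
Definition free_lift (w : seq (T * bool)) : H := foldr (fun x h => letter x * h) 1 w.

Lemma free_lift_push x w : free_lift (push x w) = letter x * free_lift w.
Proof.
case: w => [|y w] //=; case: eqP => //= ->.
by case: x => a []; rewrite /letter /= ?mulKg ?mulVKg.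
Qed.

Lemma free_liftM : {morph (fun w : free_group T => free_lift w) : u v / u * v}.
Proof.
move=> u v /=; elim: (u : seq _) => [|x w IH] /=; first by rewrite mul1g.
by rewrite free_lift_push IH mulgA.
Qed.

End FreeLift.

Definition fgen (T : choiceType) (a : T) : free_group T :=
  @FreeGroup T [:: (a, false)] isT.

Lemma free_group_ind (T : choiceType) (P : free_group T -> Prop) :
    P 1 -> (forall a w, P w -> P (fgen a * w)) ->
    (forall a w, P w -> P ((fgen a)^-1 * w)) ->
  forall w, P w.
Proof.
move=> P1 PM PV [w red]; elim: w red => [|[a b] w IH] red.
  by rewrite (_ : FreeGroup red = 1) //; apply: val_inj.
have redw := path_sorted red; have {IH} Pw := IH redw.
have pushE : push (a, b) w = (a, b) :: w.
  by case: w red {redw Pw} => //= y w /andP[/negPf->].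
case: b red pushE => red pushE.
  rewrite (_ : FreeGroup red = (fgen a)^-1 * FreeGroup redw); first exact: PV.
  by apply: val_inj; rewrite /= pushE.
rewrite (_ : FreeGroup red = fgen a * FreeGroup redw); first exact: PM.
by apply: val_inj; rewrite /= pushE.
Qed.

Definition class2 (G : groupType) := forall x y z : G, [~ [~ x, y], z] = 1.

(** The elements whose image is central form a subgroup containing all
    commutators, hence containing the second term of the lower central series;
    commutators of its elements with arbitrary ones are therefore killed. *)
Lemma morph_gamma3 (G H : groupType) (f : G -> H) :
  {morph f : x y / x * y} -> class2 H -> forall x, normal_set (gamma G 3) x -> f x = 1.
Proof.
move=> fM H2 x /(_ [set u | f u = 1]%classic); apply; split=> [|_ [c cG [z _ <-]] /=].
  apply/group_closedE; split=> [|u v /= fu fv]; first exact: morph_one.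
  by rewrite fM morph_inv // fu fv mul1g invg1.
rewrite (morph_comm fM); apply/eqP/commgP.
suff: forall z, commute (f c) z by apply.
apply: (cG [set u | forall z, commute (f u) z]%classic); split=> [|_ [u _ [v _ <-]] /= {}z].
  apply/group_closedE; split=> [z'|u v /= fu fv z'].
    by rewrite morph_one //; apply/commute_sym/commute1.
  rewrite fM morph_inv //; apply/commute_sym/commuteM; first exact/commute_sym.
  exact/commuteV/commute_sym.
by rewrite (morph_comm fM); apply/commgP/eqP.
Qed.

Section FreeNilpotent.
Variable r : nat.
Local Notation F := (free_group 'I_r).
Local Notation N := (free_nilpotent r 2).

Definition nproj (w : F) : N := \pi_(quotient_group (gamma F 3)) w.

Lemma nprojM : {morph nproj : u v / u * v}.
Proof. by move=> u v; symmetry; apply: piM. Qed.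

Lemma nproj_surj (x : N) : exists w, nproj w = x.
Proof. by exists (repr x); apply: reprK. Qed.

Definition ngen (i : 'I_r) : N := nproj (fgen i).

Lemma free_nilpotent_ind (P : N -> Prop) :
    P 1 -> (forall i x, P x -> P (ngen i * x)) ->
    (forall i x, P x -> P ((ngen i)^-1 * x)) ->
  forall x, P x.
Proof.
move=> P1 PM PV x; have [w <-] := nproj_surj x.
elim/free_group_ind: w => [|i w|i w]; first by rewrite (morph_one nprojM).
  by rewrite nprojM; apply: PM.
by rewrite nprojM (morph_inv nprojM); apply: PV.
Qed.

Lemma free_nilpotent_class2 : class2 N.
Proof.
move=> x y z; have [[u <-] [v <-] [w <-]] := And3 (nproj_surj x) (nproj_surj y) (nproj_surj z).
rewrite -!(morph_comm nprojM) -(morph_one nprojM); symmetry; apply/Defs.eq_piP.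
rewrite coset_relE invg1 mul1g => K [_ KP]; apply: KP.
exists [~ u, v]; last by exists w.
by move=> K' [_ KP']; apply: KP'; exists u => //; exists v.
Qed.

(** The morphism from the free group kills the third term of the lower central
    series, so it may be evaluated on any representative of a coset. *)
Lemma free_nilpotent_lift (H : groupType) (g : 'I_r -> H) : class2 H ->
  exists f : N -> H, {morph f : x y / x * y} /\ forall i, f (ngen i) = g i.
Proof.
move=> H2; pose f0 (w : F) := free_lift g w.
have f0M : {morph f0 : x y / x * y} := free_liftM g.
have f0_proj w : f0 (repr (nproj w)) = f0 w.
  have /(morph_gamma3 f0M H2) : normal_set (gamma F 3) ((repr (nproj w))^-1 * w).
    by rewrite -coset_relE; apply: reprP.
  by rewrite f0M (morph_inv f0M) => /(canRL (mulVKg _)); rewrite mulg1 => ->.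
exists (fun x => f0 (repr x)); split=> [x y|i].
  have [[u <-] [v <-]] := (nproj_surj x, nproj_surj y).
  by rewrite -nprojM !f0_proj f0M.
by rewrite f0_proj /f0 /= mulg1.
Qed.

End FreeNilpotent.

(** * Integer powers in groups of class 2 *)

Definition zexp (G : groupType) (x : G) (n : int) : G :=
  match n with Posz m => x ^+ m | Negz m => x ^- m.+1 end.

Section IntPower.
Variable G : groupType.
Implicit Types (x y : G) (m n : int).

Lemma zexp0 x : zexp x 0 = 1. Proof. by []. Qed.

Lemma zexpS x n : zexp x (1 + n)%R = x * zexp x n.
Proof.
case: n => [n|[|n]]; first by rewrite -PoszD /= expgS.
  by rewrite /= mulgV.
rewrite (_ : (1 + _)%R = Negz n); last by lia.
by rewrite [in RHS]/zexp expgSr invgM mulVKg.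
Qed.

Lemma zexpP x n : zexp x (n - 1)%R = x^-1 * zexp x n.
Proof. by rewrite -{2}[n](subrKC 1%R) zexpS mulKg. Qed.

Lemma zexpD x m n : zexp x (m + n)%R = zexp x m * zexp x n.
Proof.
elim/int_ind: m => [|m IH|m IH]; first by rewrite add0r mul1g.
  by rewrite intS -addrA !zexpS IH mulgA.
have -> : (- m.+1%:Z + n = - m%:Z + n - 1)%R by lia.
have -> : (- m.+1%:Z = - m%:Z - 1)%R by lia.
by rewrite !zexpP IH mulgA.
Qed.

Lemma zexpN x n : zexp x (- n)%R = (zexp x n)^-1.
Proof. by apply/esym/mulg1_eq; rewrite -zexpD addrN. Qed.

Lemma zexpVn x n : zexp x^-1 n = (zexp x n)^-1.
Proof. by case: n => n /=; rewrite expVgn. Qed.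

Lemma commute_zexp x y n : commute x y -> commute x (zexp y n).
Proof. by case: n => n xy; [|apply: commuteV]; apply: commuteX. Qed.

Lemma zexp_conj x y n : zexp x n ^ y = zexp (x ^ y) n.
Proof. by case: n => n /=; rewrite ?conjVg conjXg. Qed.

Lemma zexpMn x y n : commute x y -> zexp (x * y) n = zexp x n * zexp y n.
Proof.
move=> xy; case: n => n /=; first exact: expgMn.
rewrite -invgM -expgMn; last exact: commute_sym.
by rewrite xy.
Qed.

End IntPower.

Lemma zexp_morph (G H : groupType) (f : G -> H) (x : G) n :
  {morph f : x y / x * y} -> f (zexp x n) = zexp (f x) n.
Proof.
move=> fM; have fX m : f (x ^+ m) = f x ^+ m.
  by elim: m => [|m IH]; rewrite ?(morph_one fM) // !expgS fM IH.
by case: n => n /=; rewrite ?(morph_inv fM) fX.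
Qed.

(** Conjugating [x] by the inverse of [y] multiplies it by the central element
    [[~ y, x]], and conjugation commutes with powers. *)
Lemma class2_collect (G : groupType) (x y : G) n : class2 G ->
  y * zexp x n = zexp x n * y * zexp [~ y, x] n.
Proof.
move=> G2; have central z : commute [~ y, x] z by apply/commgP/eqP.
have -> : y * zexp x n = zexp x n ^ y^-1 * y by rewrite -conjgCV.
rewrite zexp_conj (_ : x ^ y^-1 = x * [~ y, x]); last first.
  by apply: (mulIg y); rewrite -conjgCV -mulgA (central y) mulgA commgC.
rewrite zexpMn; last exact/commute_sym.
by rewrite -!mulgA; congr (_ * _); apply/commute_sym/commute_zexp/commute_sym.
Qed.

Lemma class2_commC (G : groupType) (x y z : G) n : class2 G ->
  z * zexp [~ x, y] n = zexp [~ x, y] n * z.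
Proof. by move=> G2; apply/commute_zexp/commute_sym/commgP/eqP. Qed.

(** * Sublattices of Z^n *)

Local Open Scope ring_scope.

Lemma unitz_norm (d : int) : (d \is a GRing.unit) = (`|d|%N == 1%N).
Proof. by have -> : (d \is a GRing.unit) = (d == 1) || (d == -1) by []; lia. Qed.

(** The map [r] classifies the vectors modulo the lattice spanned by the rows of
    [B], so this is the index formula.  A Smith form B = L D R reduces it to a
    diagonal matrix: the class of [x] is given by the residues of the coordinates
    of x R^-1 modulo the diagonal entries of [D]. *)
Lemma coker_index n (B : 'M[int]_n) : \det B != 0 ->
  exists (T : finType) (r : 'rV[int]_n -> T),
    [/\ #|T| = `|\det B|%N, forall t, exists x, r x = t
      & forall x y, (exists u, x - y = u *m B) <-> r x = r y].
Proof.
have [L uL [R uR [d _ defB]]] := int_Smith_normal_form B.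
pose D : 'M[int]_n := \matrix_(i, j) (d`_i *+ (i == j :> nat)).
rewrite -/D in defB; pose e (i : 'I_n) : int := d`_i.
have detD : \det D = \prod_(i < n) e i.
  have -> : D = diag_mx (\row_i d`_i).
    by apply/matrixP => i j; rewrite !mxE.
  by rewrite det_diag; apply: eq_bigr => i _; rewrite mxE.
have normB : `|\det B|%N = (\prod_(i < n) `|e i|)%N.
  rewrite defB !det_mulmx detD !abszM.
  move: uL uR; rewrite !unitmxE !unitz_norm => /eqP-> /eqP->.
  by rewrite mul1n muln1 (big_morph absz abszM (erefl _)).
move=> detB0.
have d0 (i : 'I_n) : (0 < `|e i|)%N.
  have : (0 < `|\det B|)%N by rewrite absz_gt0.
  by rewrite normB (bigD1 i) //= muln_gt0 => /andP[].
pose c (x : 'rV[int]_n) i := (((x *m invmx R) 0 i)%R %% e i)%Z.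
have c_ge0 x i : 0 <= c x i by rewrite modz_ge0 // -absz_gt0.
have c_lt x i : (`|c x i| < `|e i|)%N.
  by rewrite -ltz_nat gez0_abs // ltz_mod // -absz_gt0.
pose T := {dffun forall i : 'I_n, 'I_(`|e i|.-1.+1)}.
pose r x : T := [ffun i => inord `|c x i|].
exists T, r; split.
- rewrite card_dep_ffun foldrE big_map big_enum normB /=.
  by apply: eq_bigr => i _; rewrite card_ord prednK.
- move=> t; exists ((\row_i (t i : nat)%:Z) *m R); apply/ffunP => i.
  rewrite ffunE /c mulmxK // mxE -modz_abs modz_small ?inord_val //.
  by have := ltn_ord (t i); rewrite {2}prednK // => lt_t; lia.
have rE x y : r x = r y <-> forall i, (e i %| (((x - y) *m invmx R) 0 i)%R)%Z.
  split=> [/ffunP rxy i|dvd]; last first.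
    apply/ffunP => i; rewrite !ffunE; congr (inord `|_|); apply/eqP.
    by rewrite eqz_mod_dvd; have := dvd i; rewrite mulmxBl !mxE.
  have := rxy i; rewrite !ffunE => /(congr1 val) /=.
  rewrite !inordK ?prednK // => cxy.
  have /eqP : c x i = c y i by rewrite -[LHS]gez0_abs // cxy gez0_abs.
  by rewrite eqz_mod_dvd mulmxBl !mxE.
move=> x y; rewrite rE; split=> [[u ->] i|dvd].
  rewrite defB !mulmxA mulmxK // mxE (bigD1 i) //= big1 ?addr0.
    by rewrite [D _ _]mxE eqxx mulr1n dvdz_mull.
  by move=> j ne; rewrite [D _ _]mxE (inj_eq val_inj) (negPf ne) mulr0.
pose w := \row_i ((((x - y) *m invmx R) 0 i)%R %/ e i)%Z.
have wD : w *m D = (x - y) *m invmx R.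
  apply/rowP => i; rewrite [LHS]mxE (bigD1 i) //= big1 ?addr0.
    by rewrite !mxE eqxx mulr1n; have := dvd i; rewrite mxE => /divzK.
  by move=> j ne; rewrite [D _ _]mxE (inj_eq val_inj) (negPf ne) mulr0.
by exists (w *m invmx L); rewrite defB !mulmxA mulmxKV // wD mulmxKV.
Qed.

(** A nonzero integral vector [e] orthogonal to all rows of [B] works: the scalar
    product with [e] vanishes on the lattice but not on [e] itself. *)
Lemma coker_infinite n (B : 'M[int]_n) : \det B = 0 ->
  exists e : 'rV[int]_n, forall i j : nat,
    (exists u, e *+ i - e *+ j = u *m B) -> i = j.
Proof.
rewrite -det_tr => /eqP/det0P[v v0 vB].
exists v => i j [u /(congr1 (mulmx^~ v^T))].
have -> : u *m B *m v^T = 0.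
  by rewrite -mulmxA -[B]trmxK -trmx_mul vB trmx0 mulmx0.
rewrite mulmxBl -!scaler_nat -!scalemxAl -scalerBl.
move=> /(congr1 (fun M : 'M_1 => M 0 0)) /eqP.
rewrite !mxE mulf_eq0 subr_eq0 => /orP[/eqP|]; first by lia.
rewrite psumr_eq0 => [/allP v_eq0|k _]; last by rewrite mxE -expr2 sqr_ge0.
case/eqP: v0; apply/rowP => k; rewrite mxE; apply/eqP.
by have := v_eq0 k (mem_index_enum k); rewrite /= mxE mulf_eq0 orbb.
Qed.

Lemma additive_mx m n (f : 'rV[int]_m -> 'rV[int]_n) :
  {morph f : x y / x + y} -> exists A, forall x, f x = x *m A.
Proof.
move=> fD; have f0 : f 0 = 0 by apply: (addrI (f 0)); rewrite -fD !addr0.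
pose g : {additive 'rV[int]_m -> 'rV[int]_n} :=
  HB.pack f (GRing.isNmodMorphism.Build _ _ f (conj f0 fD)).
exists (\matrix_i f (delta_mx 0 i)) => x.
rewrite -[f]/(g : _ -> _) {1}[x]row_sum_delta raddf_sum mulmx_sum_row.
by apply: eq_bigr => i _; rewrite rowK -[x 0 i]intz !scaler_int raddfMz.
Qed.

(** * The model of the free nilpotent group of rank 3 and class 2 *)

Lemma ord3P (P : 'I_3 -> Prop) : P 0 -> P 1 -> P 2 -> forall i, P i.
Proof.
move=> P0 P1 P2 [[|[|[|//]]] lt_i].
- by rewrite (_ : Ordinal _ = 0) //; apply: val_inj.
- by rewrite (_ : Ordinal _ = 1) //; apply: val_inj.
- by rewrite (_ : Ordinal _ = 2) //; apply: val_inj.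
Qed.

Lemma row3P (x y : 'rV[int]_3) :
  x 0 0 = y 0 0 -> x 0 1 = y 0 1 -> x 0 2 = y 0 2 -> x = y.
Proof. by move=> *; apply/rowP; apply: ord3P. Qed.

Lemma sum3 (F : 'I_3 -> int) : \sum_i F i = F 0 + F 1 + F 2.
Proof.
rewrite !big_ord_recl big_ord0 addr0 addrA.
by congr (_ + F _ + F _); apply: val_inj.
Qed.

(** A bilinear form whose antisymmetrization is, up to sign, the cross product.
    This unsymmetric choice records the commutators created when two words in
    collected order a_0^i a_1^j a_2^k are multiplied. *)
Definition beta (x y : 'rV[int]_3) : 'rV[int]_3 :=
  \row_k [:: x 0 2 * y 0 1; - (x 0 2 * y 0 0); x 0 1 * y 0 0]`_k.

Lemma betaDl x y z : beta (x + y) z = beta x z + beta y z.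
Proof. by apply: row3P; rewrite !mxE /=; lia. Qed.

Lemma betaDr x y z : beta x (y + z) = beta x y + beta x z.
Proof. by apply: row3P; rewrite !mxE /=; lia. Qed.

Lemma beta0r x : beta x 0 = 0.
Proof. by apply: row3P; rewrite !mxE /=; lia. Qed.

Lemma beta0l x : beta 0 x = 0.
Proof. by apply: row3P; rewrite !mxE /=; lia. Qed.

Lemma betaNl x y : beta (- x) y = - beta x y.
Proof. by apply: row3P; rewrite !mxE /=; lia. Qed.

Lemma betaNr x y : beta x (- y) = - beta x y.
Proof. by apply: row3P; rewrite !mxE /=; lia. Qed.

Lemma betaZr n x y : beta x (n *: y) = n *: beta x y.
Proof. by apply: row3P; rewrite !mxE /=; lia. Qed.

(** The cross product of [y] and [x]. *)
Definition omega x y := beta x y - beta y x.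

Definition heis : Type := ('rV[int]_3 * 'rV[int]_3)%type.
HB.instance Definition _ := Choice.on heis.
Local Notation hpair x z := ((x, z) : heis).

Definition heis_one : heis := (0, 0).
Definition heis_mul (g h : heis) : heis := (g.1 + h.1, g.2 + h.2 + beta g.1 h.1).
Definition heis_inv (g : heis) : heis := (- g.1, - g.2 + beta g.1 g.1).

Lemma heis_mulA : associative heis_mul.
Proof.
move=> [x z] [y w] [u v]; rewrite /heis_mul /= betaDl betaDr addrA.
by rewrite !addrA; congr (_, _); rewrite [LHS](ACl (1*2*5*3*6*4)%AC).
Qed.

Lemma heis_mul1 : left_id heis_one heis_mul.
Proof. by move=> [x z]; rewrite /heis_mul /= beta0l !add0r addr0. Qed.

Lemma heis_mulr1 : right_id heis_one heis_mul.
Proof. by move=> [x z]; rewrite /heis_mul /= beta0r !addr0. Qed.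

Lemma heis_mulV : left_inverse heis_one heis_inv heis_mul.
Proof.
by move=> [x z]; rewrite /heis_mul /= betaNl addNr [- z + _]addrC addrNK subrr.
Qed.

Lemma heis_mulrV : right_inverse heis_one heis_inv heis_mul.
Proof.
by move=> [x z]; rewrite /heis_mul /= betaNr addNKr !subrr.
Qed.

HB.instance Definition _ :=
  isGroup.Build heis heis_mulA heis_mul1 heis_mulr1 heis_mulV heis_mulrV.

Lemma heisM (g h : heis) : (g * h)%g = (g.1 + h.1, g.2 + h.2 + beta g.1 h.1).
Proof. by []. Qed.

Lemma heis_comm (g h : heis) : [~ g, h]%g = (0, omega g.1 h.1).
Proof.
apply: (mulgI (h * g)%g); rewrite -commgC !heisM /= addr0 beta0r addr0 addrC.
congr (_, _).
by rewrite /omega [h.2 + g.2]addrC -[RHS]addrA; congr (_ + _); rewrite addrC subrK.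
Qed.

Lemma heis_class2 : class2 heis.
Proof. by move=> g h k; rewrite !heis_comm /= /omega beta0l beta0r subrr. Qed.

Local Open Scope group_scope.

Section NormalForm.
Variables (G : groupType) (a : 'I_3 -> G).
Hypothesis G2 : class2 G.

(** The order and the signs match the coordinates of [beta]. *)
Definition basic_comm (k : 'I_3) : G :=
  nth 1 [:: [~ a 2, a 1]; [~ a 0, a 2]; [~ a 1, a 0]]%R k.

Definition central_word (z : 'rV[int]_3) : G :=
  (zexp (basic_comm 0%R) (z 0 0)%R * zexp (basic_comm 1%R) (z 0 1)%R
   * zexp (basic_comm 2%R) (z 0 2)%R).

Definition normal_word (g : heis) : G :=
  (zexp (a 0%R) (g.1 0 0)%R * zexp (a 1%R) (g.1 0 1)%R * zexp (a 2%R) (g.1 0 2)%R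
   * central_word g.2).

Let basic_central k x : commute x (basic_comm k).
Proof. by apply/commute_sym/commgP/eqP; elim/ord3P: k; apply: G2. Qed.

Let basic_zexpC k n x : x * zexp (basic_comm k) n = zexp (basic_comm k) n * x.
Proof. exact/commute_zexp. Qed.

Lemma central_wordD z w :
  central_word (z + w)%R = central_word z * central_word w.
Proof.
have swap (k : 'I_3) n x y :
    x * (zexp (basic_comm k) n * y) = zexp (basic_comm k) n * (x * y).
  by rewrite !mulgA basic_zexpC.
rewrite /central_word !mxE !zexpD -!mulgA; congr (_ * _).
rewrite [LHS](swap 1%R); congr (_ * _).
by rewrite [in LHS](swap 2%R) [LHS](swap 2%R).
Qed.

(** The collection process: the new letter is moved to the right across the
    powers of the generators of smaller index, and the central commutators that
    appear are those recorded by [beta]. *)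
Lemma normal_word_gen i (g : heis) :
  normal_word (hpair (delta_mx 0 i)%R 0%R * g) = a i * normal_word g.
Proof.
case: g => x z; rewrite heisM /normal_word /= add0r central_wordD.
move: (central_word z) => c.
elim/ord3P: i.
- have -> : beta (delta_mx 0 0)%R x = 0%R by apply: row3P; rewrite !mxE /=; lia.
  by rewrite /central_word !mxE /= !add0r zexpS !mulg1 !mulgA.
- have -> : central_word (beta (delta_mx 0 1)%R x) = zexp (basic_comm 2%R) (x 0 0)%R.
    by rewrite /central_word !mxE /= !mul0r oppr0 mul1r !mul1g.
  rewrite !mxE /= !add0r zexpS !mulgA (class2_collect (a 0%R) (a 1%R) _ G2) -!mulgA.
  by do 2!congr (_ * _); rewrite -[RHS](basic_zexpC 2%R) !mulgA.
- have -> : central_word (beta (delta_mx 0 2)%R x)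
      = zexp (basic_comm 0%R) (x 0 1)%R * zexp (basic_comm 1%R) (- x 0 0)%R.
    by rewrite /central_word !mxE /= !mul0r !mul1r mulg1.
  have -> : zexp (basic_comm 1%R) (- x 0 0)%R = zexp [~ a 2%R, a 0%R] (x 0 0)%R.
    by rewrite zexpN -zexpVn invgR.
  rewrite !mxE /= !add0r zexpS !mulgA (class2_collect (a 0%R) (a 2%R) _ G2) -!mulgA.
  rewrite -[in RHS](class2_commC _ _ _ _ G2) !mulgA; congr (_ * _).
  rewrite -!mulgA [in RHS](mulgA (a 2%R)).
  rewrite (class2_collect (a 1%R) (a 2%R) _ G2) -!mulgA.
  by do 3!congr (_ * _); rewrite mulgA basic_zexpC.
Qed.

Lemma normal_word1 : normal_word 1 = 1.
Proof. by rewrite /normal_word /central_word !mxE /= !mulg1. Qed.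

End NormalForm.

Lemma heis_zexp (g : heis) n : beta g.1 g.1 = 0%R ->
  zexp g n = hpair (n *: g.1)%R (n *: g.2)%R.
Proof.
move=> g0; have betaZ m : beta g.1 (m *: g.1)%R = 0%R.
  by rewrite betaZr g0 scaler0.
elim/int_ind: n => [|n IH|n IH]; first by rewrite zexp0 !scale0r.
  rewrite intS zexpS IH heisM /= betaZ addr0.
  by rewrite !scalerDl !scale1r.
rewrite (_ : (- n.+1%:Z = - n%:Z - 1)%R); last by lia.
rewrite zexpP IH; apply: (mulgI g); rewrite mulVKg heisM /= betaZ addr0.
by rewrite !scalerBl !scale1r ![(_ + (_ - _))%R]addrC !subrK.
Qed.

Definition heis_gen (i : 'I_3) : heis := (delta_mx 0 i, 0)%R.

Lemma heis_normal_word g : normal_word heis_gen g = g.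
Proof.
have gen0 i : beta (heis_gen i).1 (heis_gen i).1 = 0%R.
  by apply: row3P; elim/ord3P: i; rewrite !mxE.
have commE k : basic_comm heis_gen k = hpair 0%R (delta_mx 0 k)%R.
  rewrite /basic_comm.
  by elim/ord3P: k => /=; rewrite heis_comm; congr (_, _); apply: row3P;
    rewrite /omega !mxE.
case: g => x z.
rewrite /normal_word /central_word !commE !heis_zexp /= ?beta0l ?gen0 //.
rewrite !heisM /= !scaler0 !beta0l !beta0r !addr0 !add0r.
by congr (_, _); apply: row3P; rewrite !mxE /=; lia.
Qed.

(** The inverse of the canonical morphism is the normal form map, which commutes
    with left multiplication by generators; it is thus a left inverse by
    induction on words, and a right inverse by computing normal words in
    [heis]. *)
Theorem free_nilpotent32_heis :
  exists t : {multiplicative free_nilpotent 3 2 -> heis},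
  bijective t /\ forall i, t (ngen i) = heis_gen i.
Proof.
have [t [tM tgen]] := free_nilpotent_lift heis_gen heis_class2.
pose T : {multiplicative free_nilpotent 3 2 -> heis} :=
  HB.pack t (isMultiplicative.Build _ _ t tM).
exists T; split=> //.
have N2 := @free_nilpotent_class2 3.
pose s := normal_word (@ngen 3).
have s_gen i g : s (heis_gen i * g) = ngen i * s g by exact: normal_word_gen.
exists s => [x|g] /=.
  elim/free_nilpotent_ind: x => [|i x IH|i x IH].
  - by rewrite (morph_one tM) /s normal_word1.
  - by rewrite tM tgen s_gen IH.
  by apply: (mulgI (ngen i)); rewrite mulVKg -s_gen tM (morph_inv tM) tgen mulVKg.
rewrite -[RHS]heis_normal_word /s /normal_word /central_word !tM !(zexp_morph _ _ tM) !tgen.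
have commE k : t (basic_comm (@ngen 3) k) = basic_comm heis_gen k.
  by elim/ord3P: k; rewrite /basic_comm /= (morph_comm tM) !tgen.
by rewrite !commE.
Qed.

(** * Endomorphisms of the model *)

Local Open Scope ring_scope.

Section Endomorphism.
Variable phi : heis -> heis.
Hypothesis phiM : {morph phi : g h / (g * h)%g}.

(** The central elements are recognized as products of commutators, so they are
    mapped to central elements by any endomorphism. *)
Lemma heis_central z : exists (a b c d e f : heis),
  (0, z) = ([~ a, b] * [~ c, d] * [~ e, f])%g :> heis.
Proof.
pose u i : heis := (delta_mx 0 i, 0).
pose w i j : heis := (z 0 i *: delta_mx 0 j, 0).
exists (w 0 2), (u 1), (w 1 0), (u 2), (w 2 1), (u 0).
rewrite !heis_comm !heisM /= !addr0 !beta0r !addr0; congr (_, _).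
by apply: row3P; rewrite /omega !mxE /=; lia.
Qed.

Lemma heis_morph_central z : (phi (0, z)).1 = 0.
Proof.
have [a [b [c [d [e [f ->]]]]]] := heis_central z.
by rewrite 2!phiM !(morph_comm phiM) !heis_comm !heisM /= !addr0.
Qed.

(** On first components [phi] gives a morphism to an abelian group, which kills
    the center by [heis_morph_central]; so both diagonal blocks are additive, and
    the last identity is the image under [phi] of a commutator.  The map [q] is
    quadratic in general. *)
Lemma heis_endo : exists (A L : 'M_3) (q : 'rV_3 -> 'rV_3),
  (forall x z, phi (hpair x z) = (x *m A, z *m L + q x)) /\
  (forall x y, omega (x *m A) (y *m A) = omega x y *m L).
Proof.
have split_pair (x z : 'rV_3) : hpair x z = (hpair x 0 * hpair 0 z)%g :> heis.
  by rewrite heisM /= !addr0 beta0r addr0 add0r.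
have central_mul (z w : 'rV_3) : (0, z + w) = (hpair 0 z * hpair 0 w)%g :> heis.
  by rewrite heisM /= addr0 beta0r addr0.
have phi_central (g : heis) z : (phi g * phi (hpair 0 z))%g
    = ((phi g).1, (phi g).2 + (phi (hpair 0 z)).2) :> heis.
  by rewrite heisM heis_morph_central addr0 beta0r addr0.
have [L LE] : exists L, forall z, (phi (hpair 0 z)).2 = z *m L.
  by apply: additive_mx => z w; rewrite central_mul phiM phi_central.
have [A AE] : exists A, forall x, (phi (hpair x 0)).1 = x *m A.
  apply: additive_mx => x y.
  have -> : (x + y, 0) = (hpair x 0 * hpair y 0 * hpair 0 (- beta x y))%g :> heis.
    by rewrite !heisM /= !addr0 beta0r addr0 add0r subrr.
  by rewrite phiM phi_central /= phiM.
exists A, L, (fun x => (phi (hpair x 0)).2).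
have phiE x z : phi (hpair x z) = (x *m A, z *m L + (phi (hpair x 0)).2).
  by rewrite [in LHS]split_pair phiM phi_central AE LE addrC.
split=> // x y; rewrite -LE -(AE x) -(AE y).
by have := morph_comm phiM (hpair x 0) (hpair y 0); rewrite !heis_comm /= => ->.
Qed.

End Endomorphism.

Lemma det3 (A : 'M[int]_3) : \det A =
  A 0 0 * (A 1 1 * A 2 2 - A 1 2 * A 2 1)
  - A 0 1 * (A 1 0 * A 2 2 - A 1 2 * A 2 0)
  + A 0 2 * (A 1 0 * A 2 1 - A 1 1 * A 2 0).
Proof.
(* Reading entries at natural numbers identifies the various forms of an index. *)
pose a i j := A (inord i) (inord j).
have aE i j : A i j = a i j by rewrite /a !inord_val.
rewrite (expand_det_row _ ord0) !big_ord_recl big_ord0 /cofactor.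
rewrite !(expand_det_row _ ord0) !big_ord_recl !big_ord0 /cofactor.
rewrite !det_mx11 !mxE !aE /= /bump /= -[(1 %% 3)%N]/1%N !add0n !addn0.
rewrite -[(1 + 1)%N]/2%N -[(2 %% 3)%N]/2%N expr0 expr1 expr2; lia.
Qed.

(** The rows of [L] are the cross products of the rows of [A], that is, [L] is
    the cofactor matrix of [A]; the claim is Laplace expansion. *)
Lemma cofactorP (A L : 'M[int]_3) :
  (forall x y, omega (x *m A) (y *m A) = omega x y *m L) ->
  L *m A^T = (\det A)%:M.
Proof.
move=> AL.
have LE k i j : omega (delta_mx 0 i) (delta_mx 0 j) = delta_mx 0 k ->
    forall l, L k l = omega (row i A) (row j A) 0 l.
  by move=> e l; rewrite !rowE AL e -rowE mxE.
have L0 := LE 0 2 1 ltac:(by apply: row3P; rewrite /omega !mxE).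
have L1 := LE 1 0 2 ltac:(by apply: row3P; rewrite /omega !mxE).
have L2 := LE 2 1 0 ltac:(by apply: row3P; rewrite /omega !mxE).
apply/matrixP => k l; rewrite [LHS]mxE sum3 [RHS]mxE det3 ![A^T _ _]mxE.
by elim/ord3P: k; elim/ord3P: l; rewrite ?L0 ?L1 ?L2 /omega !mxE /=; lia.
Qed.

Section Invertible.
Variables (A L : 'M[int]_3).
Hypothesis AL : L *m A^T = (\det A)%:M.

Lemma det_cofactor : `|\det A|%N = 1%N -> `|\det L|%N = 1%N.
Proof.
move=> dA; have := congr1 determinant AL; rewrite det_mulmx det_tr det_scalar.
by move/(congr1 absz); rewrite abszM abszX dA muln1.
Qed.

(** Because (L - 1) A^T = (d - A)^T with d = det A. *)
Lemma det_cofactor_sub1 : `|\det A|%N = 1%N ->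
  `|\det (L - 1%:M)|%N = `|\det (A - (\det A)%:M)|%N.
Proof.
move=> dA.
have : (L - 1%:M) *m A^T = - (A - (\det A)%:M)^T.
  by rewrite mulmxBl mul1mx AL linearB /= tr_scalar_mx opprB.
move/(congr1 (absz \o determinant)) => /=.
rewrite det_mulmx det_tr abszM dA muln1 => ->.
by rewrite -scaleN1r detZ det_tr abszM abszX abszN1 exp1n mul1n.
Qed.

Variables (phi : heis -> heis) (q : 'rV[int]_3 -> 'rV[int]_3).
Hypothesis phiE : forall x z, phi (x, z) = (x *m A, z *m L + q x).

(** If [phi] is onto, preimages of the basis vectors form an inverse of [A] over
    the integers; conversely the two diagonal blocks [A] and [L] of [phi] are
    invertible and the system is solved block by block. *)
Lemma heis_bij_det : bijective phi <-> `|\det A|%N = 1%N.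
Proof.
split=> [[psi _ phiK]|dA].
  have /choice[f fP] i : exists x, x *m A = delta_mx 0 i :> 'rV_3.
    exists (psi (hpair (delta_mx 0 i) 0)).1.
    by have := phiK (hpair (delta_mx 0 i) 0); case: (psi _) => x z; rewrite phiE => -[].
  have : (\matrix_i f i) *m A = 1%:M.
    by apply/row_matrixP => i; rewrite row_mul rowK fP row1.
  move/(congr1 (absz \o determinant)); rewrite /= det_mulmx det1 abszM => /eqP.
  by rewrite muln_eq1 => /andP[_ /eqP].
have uA : A \in unitmx by rewrite unitmxE unitz_norm dA.
have uL : L \in unitmx by rewrite unitmxE unitz_norm (det_cofactor dA).
exists (fun g => hpair (g.1 *m invmx A) ((g.2 - q (g.1 *m invmx A)) *m invmx L)).
  by case=> x z; rewrite phiE /= mulmxK // addrK mulmxK.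
by case=> y w; rewrite phiE /= !mulmxKV // subrK.
Qed.

End Invertible.

(** The universal property gives an endomorphism mapping the generators to the
    rows of [A]; its effect on the center is then forced by [heis_endo] and
    [cofactorP], and it is invertible. *)
Lemma heis_realise (A : 'M[int]_3) : `|\det A|%N = 1%N ->
  exists phi : {multiplicative heis -> heis},
    bijective phi /\ forall g, (phi g).1 = g.1 *m A.
Proof.
move=> dA; have [t [[s tK sK] tgen]] := free_nilpotent32_heis.
have [f [fM fgen]] := free_nilpotent_lift (fun i => (row i A, 0) : heis) heis_class2.
have fsM : {morph f \o s : g h / (g * h)%g}.
  by move=> g h /=; rewrite (can2_gmulfM tK sK) fM.
pose phi : {multiplicative heis -> heis} :=
  HB.pack (f \o s) (isMultiplicative.Build _ _ (f \o s) fsM).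
have [A' [L [q [phiE AL]]]] := heis_endo fsM.
have AA' : A' = A.
  apply/row_matrixP => i; rewrite rowE.
  have := phiE (delta_mx 0 i) 0; rewrite -[(delta_mx 0 i, 0)]/(heis_gen i) -tgen /=.
  by rewrite tK fgen => -[<-].
rewrite {A'}AA' in phiE AL.
exists phi; split; first exact: (heis_bij_det (cofactorP AL) phiE).2 dA.
by case=> x z; rewrite [LHS](congr1 fst (phiE x z)).
Qed.

(** * The Reidemeister number of an automorphism of the model *)

Section Automorphism.
Variables (phi : {multiplicative heis -> heis}) (A L : 'M[int]_3).
Variable q : 'rV[int]_3 -> 'rV[int]_3.
Hypothesis phiE : forall x z, phi (x, z) = (x *m A, z *m L + q x).
Let phiM : {morph phi : g h / (g * h)%g} := gmulfM (s := phi).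
Local Notation "g ~ f" := (twisted_conjugate phi g f) (at level 70).

Let q0 : q 0 = 0.
Proof. by have := morph_one phiM; rewrite phiE mul0mx mul0mx add0r => -[]. Qed.

Lemma tc_fst (g f : heis) : g ~ f -> exists u, g.1 - f.1 = u *m (A - 1%:M).
Proof.
case: g f => [x z] [y w] [[a b]]; rewrite phiE !heisM /= => -[e _].
exists (- a); rewrite mulNmx mulmxBr mulmx1 opprB.
by rewrite (canRL (addKr _) e) [y + a]addrC addrA addrK addrC.
Qed.

Lemma tc_shift (g : heis) x u : g.1 - x = u *m (A - 1%:M) ->
  exists z, g ~ (x, z).
Proof.
move=> e; pose v : heis := (- u, 0).
have fE : (phi v * g * v^-1)%g = (x, (phi v * g * v^-1)%g.2) :> heis.
  rewrite [LHS]surjective_pairing; congr (_, _); rewrite phiE /= opprK mulNmx.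
  move: e; rewrite mulmxBr mulmx1 => /eqP; rewrite subr_eq => /eqP->.
  by rewrite addrA addKr addrAC addNr add0r.
by exists (phi v * g * v^-1)%g.2; exists v; rewrite -fE mulgVK.
Qed.

Lemma tc_central x z w u : z - w = u *m (L - 1%:M) -> hpair x z ~ hpair x w.
Proof.
move=> e; exists (hpair 0 (- u)); rewrite phiE !heisM /= mul0mx q0 !addr0 add0r.
rewrite beta0l beta0r !addr0; congr (_, _).
move: e; rewrite mulmxBr mulmx1 mulNmx => /eqP; rewrite subr_eq => /eqP->.
by rewrite addrA addKr addrC.
Qed.

(** As 1 is not an eigenvalue of [A], a conjugator that preserves the first
    component must be central. *)
Lemma tc_fibre x z w : \det (A - 1%:M) != 0 -> hpair x z ~ hpair x w ->
  exists u, z - w = u *m (L - 1%:M).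
Proof.
move=> dA [[a b]]; rewrite phiE !heisM /= => -[ea].
have a0 : a = 0.
  apply/eqP/negPn/negP => a0; case/negP: dA; apply/det0P; exists a => //.
  by apply/eqP; rewrite mulmxBr mulmx1 subr_eq0; apply/eqP/(addIr x); rewrite ea addrC.
rewrite a0 mul0mx q0 beta0l beta0r !addr0 => e; exists (- b).
rewrite mulNmx mulmxBr mulmx1 opprB (canRL (addKr _) e).
by rewrite [w + b]addrC addrA addrK addrC.
Qed.

(** Each element is first moved to one whose first component is the chosen
    representative of its class modulo A - 1; its class is then determined by
    the second component modulo L - 1. *)
Lemma heis_reidemeister_fin : \det (A - 1%:M) != 0 -> \det (L - 1%:M) != 0 ->
  reidemeister_number phi = EFin (`|\det (A - 1%:M)| * `|\det (L - 1%:M)|)%N.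
Proof.
move=> dA dL.
have [T1 [r1 [<- r1_surj r1P]]] := coker_index dA.
have [T2 [r2 [<- r2_surj r2P]]] := coker_index dL.
have [s sK] := choice r1_surj.
have /choice[w wP] (g : heis) : exists z, g ~ (s (r1 g.1), z).
  by have /r1P[u /tc_shift] : r1 g.1 = r1 (s (r1 g.1)) by rewrite sK.
have tc_r1 f g : g ~ f -> r1 g.1 = r1 f.1 by move/tc_fst/r1P.
rewrite -card_prod.
apply: (@reidemeister_number_fin _ phi _ (fun g : heis => (r1 g.1, r2 (w g)))).
  move=> [t1 t2]; have [z <-] := r2_surj t2; exists (s t1, z) => /=.
  rewrite sK; congr (_, _); apply/r2P/(tc_fibre (x := s t1) dA).
  by have := wP (s t1, z); rewrite /= sK => /twisted_conjugate_sym.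
move=> f g; split=> [gf|[e1 /r2P[u e2]]].
  rewrite /= (tc_r1 _ _ gf); congr (_, _).
  apply/r2P/(tc_fibre (x := s (r1 f.1)) dA).
  have := wP g; rewrite (tc_r1 _ _ gf) => wg.
  apply: (twisted_conjugate_trans (wP f)).
  exact: twisted_conjugate_trans gf (twisted_conjugate_sym wg).
apply: (twisted_conjugate_trans (twisted_conjugate_sym (wP f))).
by apply: twisted_conjugate_trans (wP g); rewrite /= e1; apply: tc_central e2.
Qed.

(** If A - 1 is singular, infinitely many classes are already seen on first
    components; otherwise they are found among central elements. *)
Lemma heis_reidemeister_inf : \det (A - 1%:M) * \det (L - 1%:M) = 0 ->
  reidemeister_number phi = +oo%E.
Proof.
have [dA _|dA] := eqVneq (\det (A - 1%:M)) 0.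
  have [e eP] := coker_infinite dA.
  apply: (@reidemeister_number_inf _ phi (fun i => (e *+ i, 0))).
  by move=> i j /twisted_conjugate_sym/tc_fst /= /eP.
move=> /eqP; rewrite mulf_eq0 (negPf dA) => /eqP dL.
have [e eP] := coker_infinite dL.
apply: (@reidemeister_number_inf _ phi (fun i => (0, e *+ i))).
by move=> i j /twisted_conjugate_sym /(tc_fibre dA) /eP.
Qed.

End Automorphism.

Lemma heis_reidemeister (phi : {multiplicative heis -> heis}) (A : 'M_3) :
    (forall g, (phi g).1 = g.1 *m A) -> bijective phi ->
    let R := (`|\det (A - 1%:M)| * `|\det (A - (\det A)%:M)|)%N in
  `|\det A|%N = 1%N /\
  reidemeister_number phi = if R == 0%N then +oo%E else EFin R.
Proof.
move=> phi1 phi_bij R; have [A' [L [q [phiE AL]]]] := heis_endo (gmulfM (s := phi)).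
have AA' : A' = A.
  by apply/row_matrixP => i; rewrite !rowE -(phi1 (delta_mx 0 i, 0)) phiE.
rewrite {A'}AA' in phiE AL.
have {}AL := cofactorP AL; have dA := (heis_bij_det AL phiE).1 phi_bij.
split=> //; rewrite /R -(det_cofactor_sub1 AL dA).
case: eqP => [/eqP|/eqP].
  rewrite muln_eq0 !absz_eq0 => /orP[]/eqP d0; apply: (heis_reidemeister_inf phiE);
  by rewrite d0 (mul0r, mulr0).
rewrite muln_eq0 !absz_eq0 negb_or => /andP[].
exact: heis_reidemeister_fin phiE.
Qed.

Lemma heis_spectrum (r : \bar nat) : reidemeister_spectrum heis r <->
  exists2 A : 'M[int]_3, `|\det A|%N = 1%N &
    let R := (`|\det (A - 1%:M)| * `|\det (A - (\det A)%:M)|)%N in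
    r = if R == 0%N then +oo%E else EFin R.
Proof.
split=> [[phi phi_bij <-]|[A dA rE]].
  have [A [L [q [phiE _]]]] := heis_endo (gmulfM (s := phi)).
  have phi1 g : (phi g).1 = g.1 *m A by case: g => x z; rewrite phiE.
  by have [dA RE] := heis_reidemeister phi1 phi_bij; exists A.
have [phi [phi_bij phi1]] := heis_realise dA.
by exists phi => //; rewrite rE; case: (heis_reidemeister phi1 phi_bij).
Qed.

(** * The values of the Reidemeister number *)

(** Only d = -1 needs an argument: det (A + 1) - det (A - 1) is twice the sum of
    1 and of the three principal 2 x 2 minors of [A]. *)
Lemma det_sub_parity (A : 'M[int]_3) : `|\det A|%N = 1%N ->
  exists k, \det (A - (\det A)%:M) = \det (A - 1%:M) + k *+ 2.
Proof.
move=> dA; have [->|->] : \det A = 1 \/ \det A = -1 by lia.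
  by exists 0; rewrite mul0rn addr0.
exists (A 0 0 * A 1 1 - A 0 1 * A 1 0 + A 0 0 * A 2 2 - A 0 2 * A 2 0
  + A 1 1 * A 2 2 - A 1 2 * A 2 1 + 1).
by rewrite !det3 !mxE /=; lia.
Qed.

Lemma odd_or_4dvd (m k : int) : (`|m| * `|(m + k *+ 2)%R|)%N != 0%N ->
  exists2 n, (0 < n)%N &
    (`|m| * `|(m + k *+ 2)%R| = 2 * n - 1)%N \/ (`|m| * `|(m + k *+ 2)%R| = 4 * n)%N.
Proof.
set N := (_ * _)%N => N0.
have [oddN|evenN] := boolP (odd N).
  exists (N.+1)./2; first by lia.
  by left; lia.
have : (4 %| N)%N.
  have e : odd `|(m + k *+ 2)%R| = odd `|m| by lia.
  move: evenN; rewrite /N oddM e andbb -!dvdn2 => dm.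
  by rewrite (@dvdn_mul 2 2) // dvdn2 e -dvdn2.
by case/dvdnP => n Nn; exists n; [lia | right; lia].
Qed.

(** Its characteristic polynomial is x^3 - a x^2 + b x + 1. *)
Definition companion3 (a b : int) : 'M[int]_3 :=
  \matrix_(i, j) (nth [::] [:: [:: 0; 1; 0]; [:: 0; 0; 1]; [:: -1; - b; a]] i)`_j.

Lemma det_companion3 a b : \det (companion3 a b) = -1.
Proof. by rewrite det3 !mxE /=; lia. Qed.

Lemma det_companion3_sub1 a b : \det (companion3 a b - 1%:M) = a - b - 2.
Proof. by rewrite det3 !mxE /=; lia. Qed.

Lemma det_companion3_add1 a b : \det (companion3 a b - (-1)%:M) = a + b.
Proof. by rewrite det3 !mxE /=; lia. Qed.

Local Open Scope classical_set_scope.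
Local Close Scope ring_scope.

Theorem mainTheorem3 :
  reidemeister_spectrum (free_nilpotent 3 2) =
    [set EFin (2 * n - 1)%N | n in [set n : nat | (0 < n)%N]]
    `|` [set EFin (4 * n)%N | n in [set n : nat | (0 < n)%N]]
    `|` [set +oo%E].
Proof.
have [t [t_bij _]] := free_nilpotent32_heis.
rewrite (reidemeister_spectrum_iso t_bij).
have companion_value a b : reidemeister_spectrum heis
    (let R := (`|(a - b - 2)%R| * `|(a + b)%R|)%N in
     if R == 0%N then +oo%E else EFin R).
  apply/heis_spectrum; exists (companion3 a b); first by rewrite det_companion3.
  by rewrite /= det_companion3 det_companion3_sub1 det_companion3_add1.
apply/seteqP; split=> [r /heis_spectrum[A dA ->]|r] /=.
  case: eqP => [_|/eqP]; first by right.
  have [k ->] := det_sub_parity dA => /odd_or_4dvd[n n0 RE]; left.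
  by case: RE => ->; [left | right]; exists n.
case=> [[[n /= n0 <-]|[n /= n0 <-]]|->].
(* Here a + b = 1 and b - a + 2 = 2 n - 1. *)
- have := companion_value (2 - n%:Z)%R (n%:Z - 1)%R => /=.
  rewrite (_ : (_ * _)%N = (2 * n - 1)%N); last by nia.
  by case: eqP => // e; lia.
(* Here a + b = 2 and b - a + 2 = 2 n. *)
- have := companion_value (2 - n%:Z)%R (n%:Z)%R => /=.
  rewrite (_ : (_ * _)%N = (4 * n)%N); last by nia.
  by case: eqP => // e; lia.
exact: (companion_value 0%R 0%R).
Qed.
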